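(* Let $\mathcal{G}=(\mathcal{V},\mathcal{E},\omega)$ be a finite undirected weighted graph with vertex-to-edge incidence map $\nabla$ and $K=\operatorname{diag}(\omega)\nabla$. Let $\mathcal{E}=\mathcal{E}_1\sqcup\mathcal{E}_2$ be a partition of the edge set such that both subgraphs $\mathcal{G}_l=(\mathcal{V},\mathcal{E}_l,\omega|_{\mathcal{E}_l})$, $l=1,2$, are forests. Let $\Pi_l=\nabla_l^\top(\nabla_l\nabla_l^\top)^{-1}\nabla_l$ for $l=1,2$, $\Pi=\Pi_1+\Pi_2$, and $T=\sum_{l=1}^2P_l^\top K_lK_l^\top P_l$. If 1. $\Pi_1\Pi_2=\Pi_2\Pi_1$, 2. $\ker(\Pi_1\Pi_2)\setminus\ker\Pi\neq\emptyset$, 3. $\operatorname{ran}\Pi_1\cap\operatorname{ran}\Pi_2\supsetneq\{0\}$, then $\kappa(T^{-1/2}K)=\sqrt{2}$.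
   Context: The edges of $\mathcal{G}$ carry weights $\omega:\mathcal{E}\to(0,\infty)$. The matrix $\nabla:\mathbb{R}^{\mathcal{V}}\to\mathbb{R}^{\mathcal{E}}$ is the (transposed) incidence matrix, $(\nabla u)_e=u_i-u_j$ for each edge $e=(i,j)\in\mathcal{E}$, with an arbitrarily fixed orientation of each edge. For $l=1,2$, $P_l:\mathbb{R}^{\mathcal{E}}\to\mathbb{R}^{\mathcal{E}_l}$ is the canonical projection (restriction) $P_lp=p|_{\mathcal{E}_l}$, and $\nabla_l=P_l\nabla$, $K_l=P_lK$. A forest is a graph with no cycle; for a forest $\mathcal{G}_l$, $\nabla_l^\top$ has full column rank, so $\nabla_l\nabla_l^\top$ and $K_lK_l^\top$ are invertible, and $\Pi_l$ is the orthogonal projection onto $\operatorname{ran}\nabla_l^\top$. For a nonzero real matrix $A$, the (finite) condition number is $\kappa(A)=\sigma_{\max}(A)/\sigma_{\min>0}(A)$, the ratio of the largest to the smallest nonzero singular value. *)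

(* Defs.v *)
From mathcomp Require Import all_boot all_order all_algebra.
From mathcomp Require Import boolp classical_sets reals.

Set Implicit Arguments.
Unset Strict Implicit.
Unset Printing Implicit Defensive.

Import Order.TTheory GRing.Theory Num.Theory.
Local Open Scope classical_set_scope.
Local Open Scope ring_scope.

(* Linear maps are matrices acting on column vectors. *)
Definition mxker (R : realType) m n (A : 'M[R]_(m, n)) : set 'cV[R]_n :=
  [set x | A *m x = 0].

Definition mxran (R : realType) m n (A : 'M[R]_(m, n)) : set 'cV[R]_m :=
  range (fun x : 'cV[R]_n => A *m x).

Definition psdmx (R : realType) n (A : 'M[R]_n) : Prop :=
  A^T = A /\ forall x : 'cV[R]_n, 0 <= (x^T *m A *m x) 0 0.

(* A positive semidefinite A has exactly one positive semidefinite square root;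
   the default value 0 is only returned when there is no such root. *)
Definition sqrtmx (R : realType) n (A : 'M[R]_n) : 'M[R]_n :=
  xget 0 [set S : 'M[R]_n | psdmx S /\ S *m S = A].

(* The singular values of A are the nonnegative square roots of the eigenvalues
   of A^T A. *)
Definition singular_value (R : realType) m n (A : 'M[R]_(m, n)) : set R :=
  [set s | 0 <= s /\ eigenvalue (A^T *m A) (s ^+ 2)].

(* There are finitely many singular values, so for A != 0 the supremum is the
   largest one and the infimum is the smallest nonzero one. *)
Definition cond_number (R : realType) m n (A : 'M[R]_(m, n)) : R :=
  sup (singular_value A) / inf [set s | singular_value A s /\ 0 < s].

(* A finite undirected weighted graph with vertices 'I_n and edges 'I_m. The
   edge e joins src e and tgt e; which endpoint is called src is the arbitrarily
   fixed orientation. Simplicity is not imposed: an edge set containing a loop or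
   two parallel edges is not a forest in the sense below. *)
Record wgraph (R : realType) (n m : nat) := WGraph {
  src : 'I_m -> 'I_n;
  tgt : 'I_m -> 'I_n;
  weight : 'I_m -> R;
  weight_gt0 : forall e, 0 < weight e
}.

Section Graph.
Variables (R : realType) (n m : nat) (G : wgraph R n m).

(* A dart is an edge with a direction of travel; true means from src to tgt. *)
Definition dart_from (d : 'I_m * bool) : 'I_n :=
  if d.2 then src G d.1 else tgt G d.1.

Definition dart_to (d : 'I_m * bool) : 'I_n :=
  if d.2 then tgt G d.1 else src G d.1.

(* A cycle is a nonempty closed walk without repeated edges or vertices. *)
Definition is_cycle_in (F : {set 'I_m}) (p : seq ('I_m * bool)) : bool :=
  [&& p != [::],
      all (fun d => d.1 \in F) p,
      cycle (fun d d' => dart_to d == dart_from d') p,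
      uniq [seq d.1 | d <- p]
    & uniq [seq dart_from d | d <- p]].

Definition forest (F : {set 'I_m}) : Prop := forall p, ~~ is_cycle_in F p.

Definition nablamx : 'M[R]_(m, n) :=
  \matrix_(e < m, v < n) ((v == src G e)%:R - (v == tgt G e)%:R).

Definition Kmx : 'M[R]_(m, n) := diag_mx (\row_e weight G e) *m nablamx.

(* Coordinates of R^F are numbered by the enumeration of F. *)
Definition restrmx (F : {set 'I_m}) : 'M[R]_(#|F|, m) :=
  \matrix_(i < #|F|, e < m) (enum_val i == e)%:R.

Definition nablamx_on (F : {set 'I_m}) : 'M[R]_(#|F|, n) :=
  restrmx F *m nablamx.

Definition Kmx_on (F : {set 'I_m}) : 'M[R]_(#|F|, n) := restrmx F *m Kmx.

Definition Pimx (F : {set 'I_m}) : 'M[R]_n :=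
  (nablamx_on F)^T *m invmx (nablamx_on F *m (nablamx_on F)^T) *m nablamx_on F.

Definition Tmx (E1 E2 : {set 'I_m}) : 'M[R]_m :=
  (restrmx E1)^T *m (Kmx_on E1 *m (Kmx_on E1)^T) *m restrmx E1 +
  (restrmx E2)^T *m (Kmx_on E2 *m (Kmx_on E2)^T) *m restrmx E2.

End Graph.

(* Main.v *)
Require Import Defs.
From mathcomp Require Import all_boot all_order all_algebra.
From mathcomp Require Import boolp classical_sets reals.
From mathcomp Require Import complex ring zify.

(** Put A = T^{-1/2} K. Only A^T A = K^T T^{-1} K matters for the singular
    values, and it does not involve the square root any more. In the splitting
    R^E = R^{E1} + R^{E2} the matrix T is block diagonal with blocks K_l K_l^T,
    so K^T T^{-1} K is the sum over l of K_l^T (K_l K_l^T)^{-1} K_l. Each summand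
    is the orthogonal projection onto the row space of K_l, and multiplying the
    rows of nabla_l by positive weights does not change that space: the summand
    is Pi_l. Hence A^T A = Pi_1 + Pi_2 ([preconditioned_gram]).

    A sum of two commuting projections has its spectrum in {0, 1, 2}
    ([commuting_projections_eigenvalue]). A vector x with Pi_1 Pi_2 x = 0 and
    Pi x != 0 makes Pi x an eigenvector for 1, and a nonzero vector common to
    both ranges is an eigenvector for 2. So the singular values of A include 1
    and sqrt 2, and the only other possible one is 0; the quotient of the largest
    by the smallest nonzero one is sqrt 2 ([cond_number_sqrt2]).

    Two facts make these formulas meaningful. The rows of nabla_l are linearly
    independent ([forest_row_free]): a nonzero linear relation between them is a
    nonzero circulation on the forest, whose support can be followed without
    ever turning back and must close up to a cycle. And T^{-1} has a positive
    semidefinite square root ([sqrtmxP]): over an algebraically closed extension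
    of the reals the spectral theorem diagonalizes a symmetric matrix, and a root
    of it is then a real polynomial in it, obtained by interpolation at the
    eigenvalues. *)

Set Implicit Arguments.
Unset Strict Implicit.
Unset Printing Implicit Defensive.

Import Order.TTheory GRing.Theory Num.Theory.
Local Open Scope classical_set_scope.
Local Open Scope ring_scope.

(** * Positive semidefinite matrices and their square roots *)

Section PositiveSemidefinite.
Variable R : realType.

Lemma mulmx_tr_ge0 n (u : 'rV[R]_n) : 0 <= (u *m u^T) 0 0.
Proof.
by rewrite mxE sumr_ge0// => j _; rewrite !mxE -expr2 sqr_ge0.
Qed.

Lemma mulmx_tr_eq0 n (u : 'rV[R]_n) : u *m u^T = 0 -> u = 0.
Proof.
move=> /matrixP/(_ 0 0); rewrite !mxE => /eqP.
rewrite psumr_eq0 => [/allP h|j _]; last by rewrite !mxE -expr2 sqr_ge0.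
apply/rowP => j; apply/eqP; move: (h j (mem_index_enum _)).
by rewrite !mxE -expr2 sqrf_eq0.
Qed.

Lemma gram_psd m n (B : 'M[R]_(m, n)) : psdmx (B *m B^T).
Proof.
split=> [|x]; first by rewrite trmx_mul trmxK.
have -> : x^T *m (B *m B^T) *m x = (x^T *m B) *m (x^T *m B)^T.
  by rewrite trmx_mul trmxK !mulmxA.
exact: mulmx_tr_ge0.
Qed.

Lemma psdmxD n (A B : 'M[R]_n) : psdmx A -> psdmx B -> psdmx (A + B).
Proof.
move=> [sA pA] [sB pB]; split=> [|x]; first by rewrite linearD /= sA sB.
by rewrite mulmxDr mulmxDl mxE addr_ge0.
Qed.

Lemma psdmx_congr m n (M : 'M[R]_m) (C : 'M[R]_(m, n)) :
  psdmx M -> psdmx (C^T *m M *m C).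
Proof.
move=> [symM posM]; split=> [|x]; first by rewrite !trmx_mul trmxK symM mulmxA.
by have := posM (C *m x); rewrite trmx_mul !mulmxA.
Qed.

Lemma psdmx_inv n (M : 'M[R]_n) :
  M \in unitmx -> psdmx M -> psdmx (invmx M).
Proof.
move=> uM psdM; have symV : (invmx M)^T = invmx M by rewrite trmx_inv psdM.1.
by have := psdmx_congr (invmx M) psdM; rewrite symV mulVmx// mul1mx.
Qed.

(** If v A A^T = 0 then the vector v A has norm 0, so v is a relation between
    the rows of A. *)
Lemma gram_unit m n (A : 'M[R]_(m, n)) : row_free A -> A *m A^T \in unitmx.
Proof.
move=> freeA; rewrite -row_free_unit; apply: inj_row_free => v vAA0.
apply: (row_free_inj freeA); rewrite mul0mx; apply: mulmx_tr_eq0.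
by rewrite trmx_mul mulmxA -(mulmxA v) vAA0 mul0mx.
Qed.

Lemma psdmx_eigenvalue_ge0 n (M : 'M[R]_n) a :
  psdmx M -> eigenvalue M a -> 0 <= a.
Proof.
move=> [_ posM] /eigenvalueP[v vM vn0]; have := posM v^T.
rewrite trmxK vM -scalemxAl mxE pmulr_lge0// lt_def mulmx_tr_ge0 andbT.
apply: contra vn0 => /eqP v0; apply/eqP/mulmx_tr_eq0.
by apply/matrixP => i j; rewrite !ord1 v0 mxE.
Qed.

(** The spectral theorem needs an algebraically closed field; real entries come
    back from it through this description of its real elements. *)
Lemma complexification : exists (C : numClosedFieldType)
  (f : {rmorphism R -> C}), forall z, z \is Num.real <-> exists x, z = f x.
Proof.
exists R[i], (real_complex R) => z; split=> [/complex_realP//|[x ->]].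
by rewrite complex_real eqxx.
Qed.

(** Form of the spectral theorem that stays inside the reals: a symmetric
    matrix has enough real eigenvalues for two polynomials agreeing on them to
    take the same value at the matrix. The diagonalization happens over the
    algebraically closed extension, where the diagonal entries are real because
    the matrix is Hermitian. *)
Lemma symmx_horner_eq n (M : 'M[R]_n.+1) : M^T = M ->
  exists x : 'I_n.+1 -> R, (forall i, eigenvalue M (x i)) /\
    forall p q : {poly R}, (forall i, p.[x i] = q.[x i]) ->
      horner_mx M p = horner_mx M q.
Proof.
move=> symM; have [C [f fP]] := complexification.
pose MC := map_mx f M.
have hermMC : MC \is hermsymmx.
  apply: realsym_hermsym.
    by apply/is_hermitianmxP; rewrite expr0 scale1r map_mx_id// /MC map_trmx symM.
  by apply/mxOverP => i j; rewrite mxE; apply/fP; exists (M i j).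
have /mxOverP dreal := hermitian_spectral_diag_real hermMC.
have /orthomx_spectralP := hermitian_normalmx hermMC.
have := spectral_unit MC.
move: (spectralmx MC) (spectral_diag MC) dreal => P d dreal Punit MCE.
have /choice[x dx] : forall i, exists x, d 0 i = f x.
  by move=> i; apply/fP/dreal.
have dE : d = map_mx f (\row_i x i) by apply/rowP => i; rewrite !mxE.
exists x; split=> [i|p q pq].
  (* The characteristic polynomial brings the eigenvalue back to the reals. *)
  rewrite eigenvalue_root_char -(fmorph_root f) map_char_poly.
  rewrite -eigenvalue_root_char; apply/eigenvalueP; exists (row i P).
    rewrite -row_mul [map_mx f M]MCE !mulmxA mulmxV// mul1mx row_mul row_diag_mx.
    by rewrite -scalemxAl -rowE dx.
  apply/eqP => Pi0; have := Punit; rewrite unitmxE (expand_det_row _ i).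
  rewrite big1 ?unitr0// => j _.
  by move/rowP/(_ j): Pi0; rewrite !mxE => ->; rewrite mul0r.
have hornerE r : map_mx f (horner_mx M r) =
    invmx P *m diag_mx (map_mx f (\row_i r.[x i])) *m P.
  rewrite map_horner_mx [map_mx f M]MCE horner_mx_uconjC// horner_mx_diag dE.
  congr (_ *m diag_mx _ *m _).
  by apply/rowP => i; rewrite !mxE horner_map.
apply: (@map_mx_inj _ _ f); rewrite !hornerE.
by congr (_ *m diag_mx (map_mx _ _) *m _); apply/rowP => i; rewrite !mxE.
Qed.

(** Newton interpolation: a new node is added with a multiple of the polynomial
    that vanishes at the earlier nodes. *)
Lemma interpolation (f : R -> R) (s : seq R) :
  exists p : {poly R}, {in s, forall x, p.[x] = f x}.
Proof.
elim: s => [|a s [p pP]]; first by exists 0.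
have [as_|nas] := boolP (a \in s).
  by exists p => x /predU1P[->|]; exact: pP.
pose r := \prod_(b <- s) ('X - b%:P).
have ra : r.[a] != 0 by rewrite -rootE root_prod_XsubC.
exists (p + ((f a - p.[a]) / r.[a]) *: r) => x.
rewrite inE hornerD hornerZ => /predU1P[->|xs].
  by rewrite divfK// addrC subrK.
have /rootP -> : root r x by rewrite root_prod_XsubC.
by rewrite mulr0 addr0 pP.
Qed.

Lemma horner_mx_sym n (M : 'M[R]_n.+1) p :
  M^T = M -> (horner_mx M p)^T = horner_mx M p.
Proof.
move=> symM; elim/poly_ind: p => [|p c IH]; first by rewrite rmorph0 trmx0.
rewrite rmorphD rmorphM /= horner_mx_X horner_mx_C linearD /= tr_scalar_mx.
by congr (_ + _); rewrite trmx_mul IH symM; apply: comm_mx_horner.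
Qed.

(** Interpolating the fourth root at the eigenvalues gives a polynomial p with
    p(M)^4 = M. Then p(M)^2 is a square root of M, and it is positive
    semidefinite because p(M) is symmetric: fourth roots make the positivity
    of the square root immediate. *)
Lemma sqrtmxP n (M : 'M[R]_n) : psdmx M ->
  psdmx (sqrtmx M) /\ sqrtmx M *m sqrtmx M = M.
Proof.
move=> psdM; rewrite /sqrtmx.
apply: (@xgetPex _ 0 [set S : 'M[R]_n | psdmx S /\ S *m S = M]).
case: n M psdM => [|n] M psdM.
  by exists M; split=> //; rewrite [LHS]flatmx0 [RHS]flatmx0.
have [x [eigx xE]] := symmx_horner_eq psdM.1.
have [p pE] := interpolation (fun t => Num.sqrt (Num.sqrt t))
  [seq x i | i <- enum 'I_n.+1].
have px i : p.[x i] = Num.sqrt (Num.sqrt (x i)).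
  by apply: pE; apply: map_f; rewrite mem_enum.
exists (horner_mx M p *m horner_mx M p); split.
  by rewrite -{2}(horner_mx_sym p psdM.1); apply: gram_psd.
rewrite -[RHS]horner_mx_X.
change (horner_mx M p * horner_mx M p * (horner_mx M p * horner_mx M p) =
  horner_mx M 'X).
rewrite -!rmorphM; apply: xE => i; rewrite !hornerM hornerX px -!expr2.
by rewrite !sqr_sqrtr ?sqrtr_ge0// (psdmx_eigenvalue_ge0 psdM (eigx i)).
Qed.

End PositiveSemidefinite.

(** * Orthogonal projection onto the row space *)

Section RowSpaceProjection.
Variable R : realType.

Lemma invmx_uniq n (A B : 'M[R]_n) : A *m B = 1%:M -> invmx A = B.
Proof.
move=> AB1; have [Aunit _] := mulmx1_unit AB1.
by rewrite -[LHS]mulmx1 -AB1 mulKmx.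
Qed.

Definition rowproj m n (A : 'M[R]_(m, n)) : 'M[R]_n :=
  A^T *m invmx (A *m A^T) *m A.

Lemma rowproj_sym m n (A : 'M[R]_(m, n)) : (rowproj A)^T = rowproj A.
Proof.
by rewrite /rowproj !trmx_mul trmx_inv trmx_mul trmxK !mulmxA.
Qed.

Lemma rowproj_idem m n (A : 'M[R]_(m, n)) :
  row_free A -> rowproj A *m rowproj A = rowproj A.
Proof.
move=> /gram_unit uA; rewrite /rowproj !mulmxA -(mulmxA _ A A^T).
by rewrite mulmxKV.
Qed.

(** An invertible U does not change the row space, so the factors U cancel. *)
Lemma rowproj_mull m n (U : 'M[R]_m) (A : 'M[R]_(m, n)) :
  U \in unitmx -> row_free A -> rowproj (U *m A) = rowproj A.
Proof.
move=> uU /gram_unit uA; rewrite /rowproj.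
have uUT : U^T \in unitmx by rewrite unitmx_tr.
have -> : invmx (U *m A *m (U *m A)^T) =
    invmx U^T *m invmx (A *m A^T) *m invmx U.
  apply: invmx_uniq; rewrite trmx_mul !mulmxA mulmxK//.
  by rewrite -(mulmxA U) mulmxK// mulmxV.
by rewrite trmx_mul !mulmxA mulmxK// mulmxKV.
Qed.

End RowSpaceProjection.

(** * Restriction to a set of edges *)

Section Restriction.
Variables (R : realType) (m : nat).
Implicit Types F E : {set 'I_m}.
Local Notation restr := (@restrmx R m).

Lemma restrmxK F : restr F *m (restr F)^T = 1%:M.
Proof.
apply/matrixP => i j; rewrite !mxE (bigD1 (enum_val i)) //= big1 ?addr0.
  by rewrite !mxE eqxx mul1r eq_sym (inj_eq enum_val_inj).
by move=> e en; rewrite !mxE eq_sym (negbTE en) mul0r.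
Qed.

Lemma restrmx_disjoint E F :
  E :&: F = finset.set0 -> restr E *m (restr F)^T = 0.
Proof.
move=> dEF; apply/matrixP => i j; rewrite !mxE big1// => e _; rewrite !mxE.
have [ei|_] := eqVneq (enum_val i) e; last by rewrite mul0r.
have [ej|_] := eqVneq (enum_val j) e; last by rewrite mulr0.
have : e \in E :&: F by rewrite inE -{1}ei -ej !enum_valP.
by rewrite dEF inE.
Qed.

Lemma tr_restrmxK F : (restr F)^T *m restr F = diag_mx (\row_e (e \in F)%:R).
Proof.
apply/matrixP => e e'; rewrite !mxE; have [eF|eF] := boolP (e \in F).
  rewrite (bigD1 (enum_rank_in eF e)) //= big1 => [|i ine].
    by rewrite !mxE !enum_rankK_in// eqxx mul1r addr0.
  rewrite !mxE; have [eie|_] := eqVneq (enum_val i) e; last by rewrite mul0r.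
  by move: ine; rewrite -(inj_eq enum_val_inj) eie enum_rankK_in// eqxx.
rewrite mul0rn big1// => i _; rewrite !mxE.
have [eie|_] := eqVneq (enum_val i) e; last by rewrite mul0r.
by rewrite -eie enum_valP in eF.
Qed.

Lemma restrmx_partition E F :
  E :|: F = finset.setT -> E :&: F = finset.set0 ->
  (restr E)^T *m restr E + (restr F)^T *m restr F = 1%:M.
Proof.
move=> cEF dEF; rewrite !tr_restrmxK; apply/matrixP => e e'; rewrite !mxE.
rewrite -mulrnDl; congr (_ *+ _).
move/setP/(_ e): cEF; move/setP/(_ e): dEF; rewrite !inE.
by case: (e \in E); case: (e \in F) => //= _ _; rewrite ?addr0 ?add0r.
Qed.

Lemma restrmx_diag (w : 'I_m -> R) F :
  restr F *m diag_mx (\row_e w e) =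
  diag_mx (\row_i w (enum_val i)) *m restr F.
Proof.
apply/matrixP => i e; rewrite mul_mx_diag mul_diag_mx !mxE mulrC.
by have [->|_] := eqVneq (enum_val i) e; rewrite ?mulr0.
Qed.

End Restriction.

(** * Forests have linearly independent incidence rows *)

Section ForestRank.
Variables (R : realType) (n m : nat) (G : wgraph R n m).
Implicit Types F D : {set 'I_m}.

(** A walk that never takes the same edge twice in a row, on a finite graph,
    contains a cycle: stop at the first vertex that was visited before, and
    keep the part of the walk since that visit. Its vertices are distinct by
    minimality; an edge used twice in it would be traversed in both
    directions, hence in consecutive steps, which is excluded. *)
Lemma cycle_of_successor F (D : pred ('I_m * bool)) d0 f : D d0 ->
  (forall d, D d -> [/\ d.1 \in F, D (f d),
      dart_from G (f d) = dart_to G d & (f d).1 != d.1]) ->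
  exists p, is_cycle_in G F p.
Proof.
move=> Dd0 Df; pose w k := iter k f d0; pose v k := dart_from G (w k).
have Dw k : D (w k) by elim: k => //= k /Df[].
have vS k : v k.+1 = dart_to G (w k) by case: (Df _ (Dw k)).
have wS k : (w k.+1).1 != (w k).1 by case: (Df _ (Dw k)).
(* The n + 1 vertices v 0, ..., v n cannot be distinct. *)
have exj : exists j, ~~ uniq [seq v k | k <- iota 0 j.+1].
  exists n; apply/negP => /card_uniqP; rewrite size_map size_iota => cv.
  by have := max_card [in [seq v k | k <- iota 0 n.+1]]; rewrite cv card_ord ltnn.
case: (ex_minnP exj) => j nuj minj; clear exj.
have uj : uniq [seq v k | k <- iota 0 j].
  case: j minj {nuj} => // j minj; apply/negPn/negP => /minj.
  by rewrite ltnn.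
have [i ij vij] : exists2 i, (i < j)%N & v i = v j.
  move: nuj; rewrite -addn1 iotaD map_cat cat_uniq uj /= orbF andbT negbK.
  by case/mapP => i; rewrite mem_iota => /andP[_ ij] ->; exists i.
have vinj a b : (a < j)%N -> (b < j)%N -> v a = v b -> a = b.
  move=> aj bj vab; apply/eqP; move: (nth_uniq (v 0%N) (s := [seq v k | k <- iota 0 j])).
  move=> /(_ a b); rewrite size_map size_iota => /(_ aj bj uj) <-.
  by rewrite !(nth_map 0%N) ?size_iota// !nth_iota// !add0n vab.
pose s := (j - i).-1.
have js : j = (i + s.+1)%N by rewrite /s; lia.
exists [seq w k | k <- iota i s.+1]; apply/and5P; split=> //.
- by apply/allP => d /mapP[k _ ->]; case: (Df _ (Dw k)).
- rewrite [iota _ _]/= /= rcons_path; apply/andP; split.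
    by elim: (s) (i) => // t IH k; apply/andP; split; [rewrite -vS|exact: IH].
  rewrite last_map -vS.
  have -> : last i (iota i.+1 s) = (i + s)%N.
    by case: (s) => [|s']; rewrite ?addn0// -[s'.+1]addn1 iotaD last_cat /=; lia.
  by rewrite -addnS -js -vij.
- rewrite -map_comp map_inj_in_uniq ?iota_uniq//.
  have key a b : (a < b)%N -> (b < j)%N -> (w a).1 = (w b).1 -> False.
    move=> ab bj wab; have aj : (a < j)%N by exact: ltn_trans bj.
    have [b2|b2] := eqVneq (w a).2 (w b).2.
      have vab : v a = v b.
        by rewrite /v (_ : w a = w b)//; apply: injective_projections.
      by move: ab; rewrite (vinj _ _ aj bj vab) ltnn.
    (* The dart b is the reverse of the dart a, so it starts where a ends. *)
    have vab : v b = v a.+1.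
      rewrite vS /v /dart_from /dart_to wab; move: b2.
      by case: (w a).2; case: (w b).2.
    have eb : b = a.+1 by apply: vinj => //; exact: leq_ltn_trans bj.
    by have := wS a; rewrite -eb wab eqxx.
  move=> a b; rewrite !mem_iota -js => /andP[_ aj] /andP[_ bj] /= wab.
  by case: (ltngtP a b) => // ab; [case: (key a b)|case: (key b a)].
- rewrite -map_comp map_inj_in_uniq ?iota_uniq// => a b.
  by rewrite !mem_iota -js => /andP[_ aj] /andP[_ bj]; exact: vinj.
Qed.

Lemma forest_loopless F e : forest G F -> e \in F -> src G e != tgt G e.
Proof.
move=> forF eF; apply/negP => /eqP loop; case/negP: (forF [:: (e, true)]).
by rewrite /is_cycle_in /= eF /dart_to /dart_from /= loop eqxx.
Qed.

(** Kirchhoff's law at the end vertex of d: the coefficients of z on the edges at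
    this vertex add up to zero with signs, so d cannot be the only edge there
    with a nonzero coefficient. Loops must be excluded, as a loop contributes
    zero to the balance. *)
Lemma flow_continues F (z : 'rV[R]_m) d : forest G F ->
  (forall e, z 0 e != 0 -> e \in F) -> z *m nablamx G = 0 -> z 0 d.1 != 0 ->
  exists d', [&& z 0 d'.1 != 0, dart_from G d' == dart_to G d & d'.1 != d.1].
Proof.
move=> forF zF zker zd; apply/existsP; apply: contraT => /existsPn stuck.
have /negbTE ln := forest_loopless forF (zF _ zd).
have nl : (tgt G d.1 == src G d.1) = false by rewrite eq_sym.
move/rowP/(_ (dart_to G d)): zker; rewrite !mxE (bigD1 d.1) //=.
rewrite big1 => [|e ed].
  rewrite addr0 mxE /dart_to => /eqP; rewrite mulf_eq0 (negbTE zd).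
  by case: d.2; rewrite eqxx ?ln ?nl ?sub0r ?subr0 ?oppr_eq0 oner_eq0.
have [->|ze] := eqVneq (z 0 e) 0; first by rewrite mul0r.
have := stuck (e, true); have := stuck (e, false).
rewrite /dart_from /= ze ed /= !andbT ![_ == dart_to G d]eq_sym mxE.
by move=> /negbTE-> /negbTE->; rewrite subrr mulr0.
Qed.

(** A relation y between the rows, extended by zero to a vector z on all edges,
    is a circulation supported in F. If z were nonzero, [flow_continues] would
    provide the walk from which [cycle_of_successor] extracts a cycle. *)
Lemma forest_row_free F : forest G F -> row_free (nablamx_on G F).
Proof.
move=> forF; apply: inj_row_free => y; rewrite /nablamx_on mulmxA.
set z := y *m restrmx R F => zker.
have yz : y = z *m (restrmx R F)^T by rewrite /z -mulmxA restrmxK mulmx1.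
have zF e : z 0 e != 0 -> e \in F.
  apply: contraR => eF; rewrite /z mxE big1// => i _; rewrite mxE.
  have [ie|_] := eqVneq (enum_val i) e; last by rewrite mulr0.
  by rewrite -ie enum_valP in eF.
suff z0 : z = 0 by rewrite yz z0 mul0mx.
apply/rowP => e; rewrite [RHS]mxE; apply/eqP/contraT => ze.
have /choice[f fP] : forall d, exists d', z 0 d.1 != 0 ->
    [&& z 0 d'.1 != 0, dart_from G d' == dart_to G d & d'.1 != d.1].
  move=> d; have [zd|zd] := eqVneq (z 0 d.1) 0; first by exists d.
  by have [d' d'P] := flow_continues forF zF zker zd; exists d'.
have [|d zd|p cp] := @cycle_of_successor F (fun d => z 0 d.1 != 0) (e, true) f.
- by [].
- by have /and3P[zfd /eqP fd ne] := fP d zd; split=> //; exact: zF.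
- by have := forF p; rewrite cp.
Qed.

End ForestRank.

(** * Spectrum of a sum of two commuting projections *)

Section CommutingProjections.
Variables (R : realType) (n : nat) (P Q : 'M[R]_n).
Hypotheses (PP : P *m P = P) (QQ : Q *m Q = Q) (PQ : P *m Q = Q *m P).

Let sqrS : (P + Q) *m (P + Q) = P + Q + 2 *: (P *m Q).
Proof.
rewrite mulmxDl !mulmxDr PP QQ -PQ scaler_nat mulr2n.
by rewrite [P *m Q + Q]addrC addrACA.
Qed.

Let mulPQS : P *m Q *m (P + Q) = 2 *: (P *m Q).
Proof.
rewrite mulmxDr -[P *m Q *m Q]mulmxA QQ PQ -[Q *m P *m P]mulmxA PP.
by rewrite scaler_nat mulr2n.
Qed.

(** With S = P + Q one has S^2 = S + 2 P Q and P Q S = 2 P Q, so S is annihilated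
    by (X - 2) (X^2 - X). *)
Lemma commuting_projections_eigenvalue a :
  eigenvalue (P + Q) a -> [\/ a = 0, a = 1 | a = 2].
Proof.
move=> /eigenvalueP[v va vn0].
have vPQ : 2 *: (v *m (P *m Q)) = (a * a - a) *: v.
  have := congr1 (mulmx v) sqrS; rewrite [RHS]mulmxDr mulmxA !va -scalemxAl va.
  by rewrite scalerA scalerBl => ->; rewrite [RHS]addrC addKr -scalemxAr.
have aE : a *: ((a * a - a) *: v) = 2 *: ((a * a - a) *: v).
  rewrite scalerA mulrC -scalerA -va scalemxAl -vPQ -scalemxAl -mulmxA mulPQS.
  by rewrite -scalemxAr.
have : ((a - 2) * (a * a - a)) *: v = 0.
  by rewrite -scalerA scalerBl aE subrr.
move/eqP; rewrite scaler_eq0 (negbTE vn0) orbF.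
have -> : (a - 2) * (a * a - a) = (a - 2) * (a * (a - 1)) by ring.
rewrite !mulf_eq0 !subr_eq0 => /or3P[]/eqP->.
- by constructor 3.
- by constructor 1.
- by constructor 2.
Qed.

Hypotheses (symP : P^T = P) (symQ : Q^T = Q).

(* [eigenvalue] speaks of row vectors; for a symmetric matrix columns will do. *)
Let eigenvalue_col (y : 'cV[R]_n) a : (P + Q) *m y = a *: y -> y != 0 -> eigenvalue (P + Q) a.
Proof.
move=> ya yn0; apply/eigenvalueP; exists y^T; last by rewrite trmx_eq0.
by rewrite -[in LHS]symP -[in LHS]symQ -linearD /= -trmx_mul ya linearZ.
Qed.

(** On the kernel of P Q, S^2 = S, so S x is fixed by S. *)
Lemma eigenvalue1_sum :
  mxker (P *m Q) `\` mxker (P + Q) !=set0 -> eigenvalue (P + Q) 1.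
Proof.
move=> [x [PQx /eqP Sx]]; apply: (eigenvalue_col (y := (P + Q) *m x)) => //.
by rewrite mulmxA sqrS mulmxDl -scalemxAl PQx scaler0 addr0 scale1r.
Qed.

Lemma eigenvalue2_sum :
  [set 0] `<` mxran P `&` mxran Q -> eigenvalue (P + Q) 2.
Proof.
move=> [/(_ 0 erefl) _ nsub]; have [z [[a _ az] [b _ bz]] zn0] :
    exists2 z, (mxran P `&` mxran Q) z & z != 0.
  apply: contrapT => nz; apply: nsub => z Pz; apply: contrapT => zn0.
  by apply: nz; exists z => //; apply/eqP.
apply: (eigenvalue_col (y := z)) => //.
have Pz : P *m z = z by rewrite -az /= mulmxA PP.
have Qz : Q *m z = z by rewrite -bz /= mulmxA QQ.
by rewrite mulmxDl Pz Qz scaler_nat mulr2n.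
Qed.

End CommutingProjections.

Lemma cond_number_sqrt2 (R : realType) m n (A : 'M[R]_(m, n)) :
  (forall a, eigenvalue (A^T *m A) a -> [\/ a = 0, a = 1 | a = 2]) ->
  eigenvalue (A^T *m A) 1 -> eigenvalue (A^T *m A) 2 ->
  cond_number A = Num.sqrt 2.
Proof.
move=> spec e1 e2.
have sqrt2_ge1 : 1 <= Num.sqrt 2 :> R.
  by rewrite -[leLHS]sqrtr1 ler_sqrt ?ler1n.
have sv s : singular_value A s -> [\/ s = 0, s = 1 | s = Num.sqrt 2].
  move=> [s0 /spec s2]; have sE : s = Num.sqrt (s ^+ 2).
    by rewrite sqrtr_sqr ger0_norm.
  by case: s2 => s2; rewrite sE s2 ?sqrtr0 ?sqrtr1;
    [constructor 1|constructor 2|constructor 3].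
have sv1 : singular_value A 1 by split; rewrite ?ler01 ?expr1n.
have sv2 : singular_value A (Num.sqrt 2).
  by split; rewrite ?sqrtr_ge0 ?sqr_sqrtr.
have ub2 : ubound (singular_value A) (Num.sqrt 2).
  by move=> s /sv[] ->; rewrite ?sqrtr_ge0.
have lb1 : lbound [set s | singular_value A s /\ 0 < s] 1.
  by move=> s [/sv[] ->]; rewrite ?ltxx.
rewrite /cond_number; have -> : sup (singular_value A) = Num.sqrt 2.
  apply/le_anti/andP; split; first by apply: ge_sup => //; exists 1.
  by apply: ub_le_sup => //; exists (Num.sqrt 2).
have -> : inf [set s | singular_value A s /\ 0 < s] = 1; last by rewrite divr1.
apply/le_anti/andP; split; last by apply: lb_le_inf => //; exists 1.
by apply: ge_inf => //; exists 1.
Qed.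

(** * The inverse of T and the Gram matrix of the preconditioned K *)

Section InversePreconditioner.
Variables (R : realType) (n m : nat) (G : wgraph R n m) (E1 E2 : {set 'I_m}).

Lemma Kmx_onE F : Kmx_on G F =
  diag_mx (\row_i weight G (enum_val i)) *m nablamx_on G F.
Proof. by rewrite /Kmx_on /Kmx mulmxA restrmx_diag -mulmxA. Qed.

Lemma weight_diag_unit (F : {set 'I_m}) :
  diag_mx (\row_(i < #|F|) weight G (enum_val i)) \in unitmx.
Proof.
rewrite unitmxE det_diag unitfE prodf_seq_neq0; apply/allP => i _.
by rewrite mxE gt_eqF// weight_gt0.
Qed.

Lemma Kmx_on_row_free F : forest G F -> row_free (Kmx_on G F).
Proof.
move=> /forest_row_free freeN; apply: inj_row_free => v.
rewrite Kmx_onE mulmxA -(mul0mx _ (nablamx_on G F)) => /(row_free_inj freeN) v0.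
by rewrite -[v](mulmxK (weight_diag_unit F)) v0 mul0mx.
Qed.

Lemma rowproj_Kmx_on F : forest G F -> rowproj (Kmx_on G F) = Pimx G F.
Proof.
move=> /forest_row_free freeN.
by rewrite Kmx_onE rowproj_mull// weight_diag_unit.
Qed.

Hypotheses (hcover : E1 :|: E2 = finset.setT) (hdisj : E1 :&: E2 = finset.set0).
Hypotheses (hforest1 : forest G E1) (hforest2 : forest G E2).

Local Notation R1 := (restrmx R E1).
Local Notation R2 := (restrmx R E2).
Local Notation H1 := (Kmx_on G E1 *m (Kmx_on G E1)^T).
Local Notation H2 := (Kmx_on G E2 *m (Kmx_on G E2)^T).

(** T is block diagonal for the partition of the edges, so it is inverted block
    by block. *)
Lemma invmx_Tmx : invmx (Tmx G E1 E2) =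
  R1^T *m invmx H1 *m R1 + R2^T *m invmx H2 *m R2.
Proof.
apply: invmx_uniq; rewrite /Tmx.
have u1 := gram_unit (Kmx_on_row_free hforest1).
have u2 := gram_unit (Kmx_on_row_free hforest2).
have R12 := restrmx_disjoint R hdisj.
have R21 : R2 *m R1^T = 0 by rewrite -[LHS]trmxK trmx_mul trmxK R12 trmx0.
move: (H1) (H2) u1 u2 => A1 A2 u1 u2.
rewrite mulmxDl !mulmxDr !mulmxA -!(mulmxA _ R1 R1^T) -!(mulmxA _ R1 R2^T).
rewrite -!(mulmxA _ R2 R1^T) -!(mulmxA _ R2 R2^T) !restrmxK R12 R21.
rewrite !mulmx0 !mul0mx addr0 add0r !mulmx1 !mulmxK//.
exact: restrmx_partition.
Qed.

Lemma invmx_Tmx_psd : psdmx (invmx (Tmx G E1 E2)).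
Proof.
rewrite invmx_Tmx.
by apply: psdmxD; apply/psdmx_congr/psdmx_inv/gram_psd;
  apply/gram_unit/Kmx_on_row_free.
Qed.

(** K^T R_l^T = K_l^T, so the blocks of the inverse of T turn K^T T^{-1} K into
    the sum of the projections onto the row spaces of K_1 and K_2. *)
Lemma preconditioned_gram : (Kmx G)^T *m invmx (Tmx G E1 E2) *m Kmx G =
  Pimx G E1 + Pimx G E2.
Proof.
rewrite invmx_Tmx mulmxDr mulmxDl -!rowproj_Kmx_on// /rowproj.
by rewrite /Kmx_on !trmx_mul !mulmxA.
Qed.

End InversePreconditioner.

Theorem theorem2 (R : realType) (n m : nat) (G : wgraph R n m)
    (E1 E2 : {set 'I_m})
    (hcover : E1 :|: E2 = finset.setT) (hdisj : E1 :&: E2 = finset.set0)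
    (hforest1 : forest G E1) (hforest2 : forest G E2)
    (hcomm : Pimx G E1 *m Pimx G E2 = Pimx G E2 *m Pimx G E1)
    (hker : mxker (Pimx G E1 *m Pimx G E2)
              `\` mxker (Pimx G E1 + Pimx G E2) !=set0)
    (hran : [set 0] `<` mxran (Pimx G E1) `&` mxran (Pimx G E2)) :
  cond_number (sqrtmx (invmx (Tmx G E1 E2)) *m Kmx G) = Num.sqrt 2.
Proof.
have [[symS _] SS] := sqrtmxP (invmx_Tmx_psd hcover hdisj hforest1 hforest2).
have idem F (forF : forest G F) := rowproj_idem (forest_row_free forF).
have sym F : (Pimx G F)^T = Pimx G F := rowproj_sym (nablamx_on G F).
have gramE : (sqrtmx (invmx (Tmx G E1 E2)) *m Kmx G)^T *m
    (sqrtmx (invmx (Tmx G E1 E2)) *m Kmx G) = Pimx G E1 + Pimx G E2.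
  rewrite trmx_mul symS mulmxA -(mulmxA (Kmx G)^T) SS.
  exact: preconditioned_gram.
apply: cond_number_sqrt2; rewrite gramE.
- by move=> a; apply: commuting_projections_eigenvalue => //; exact: idem.
- by apply: eigenvalue1_sum => //; exact: idem.
- by apply: eigenvalue2_sum => //; exact: idem.
Qed.
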